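(* Let $k\ge 1$ be real, let $n\ge 1$, and let $P(z)=\sum_{j=0}^{n}a_jz^j=a_n(z-z_1)(z-z_2)\cdots(z-z_n)$ be a complex polynomial of degree $n$ having all its zeros $z_1,\dots,z_n$ in $|z|\le k$. Let $\gamma=(\gamma_1,\dots,\gamma_n)$ be an $n$-tuple of non-negative real numbers, not all zero, and put $\Lambda=\sum_{j=1}^{n}\gamma_j$ and $\gamma_m=\min\{\gamma_1,\dots,\gamma_n\}$. Then for every $\alpha\in\mathbb{C}$ with $|\alpha|\ge k$, $$\max_{|z|=1}|D_\alpha^\gamma[P](z)|\ \ge\ \left(\frac{|\alpha|-k}{1+k^n}\right)\left[\Lambda+\gamma_m\left(\frac{k^n|a_n|-|a_0|}{k^n|a_n|+|a_0|}\right)\right]\max_{|z|=1}|P(z)|,$$ where $D_\alpha^\gamma[P]$ is the generalized polar derivative of $P$.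
   Context: For $P(z)=c(z-z_1)\cdots(z-z_n)$ with $c\neq 0$ (zeros listed with multiplicity, in a fixed order) and $\gamma=(\gamma_1,\dots,\gamma_n)$ an $n$-tuple of non-negative reals, not all zero, with $\Lambda=\sum_{j=1}^n\gamma_j$, the generalized derivative of $P$ is the polynomial $$P^\gamma(z):=P(z)\sum_{j=1}^n\frac{\gamma_j}{z-z_j}=\sum_{j=1}^n\gamma_j P_j(z),\qquad P_j(z)=c\prod_{i\ne j}(z-z_i),$$ where the second expression defines $P^\gamma$ at the zeros of $P$. For $\alpha\in\mathbb{C}$ the generalized polar derivative of $P$ is $$D_\alpha^\gamma[P](z):=\Lambda P(z)+(\alpha-z)P^\gamma(z).$$ *)

(* Defs.v *)
From HB Require Import structures.
From mathcomp Require Export all_boot all_order all_algebra complex.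
From mathcomp Require Export all_classical all_reals all_analysis.
Export Order.TTheory GRing.Theory Num.Theory.
Export numFieldNormedType.Exports.
Export ComplexField.Normc.
Set Implicit Arguments.
Unset Strict Implicit.
Unset Printing Implicit Defensive.
Local Open Scope classical_set_scope.
Local Open Scope ring_scope.
Local Open Scope complex_scope.

(* The zeros are passed as a family [z], so that the weight [gam j] is attached
   to the zero [z j]; the notions below are meant for a polynomial [P] equal to
   [lead_coef P *: \prod_j ('X - (z j)%:P)]. *)

Definition gen_deriv (R : realType) (n : nat) (P : {poly R[i]})
    (z : 'I_n -> R[i]) (gam : 'I_n -> R) : {poly R[i]} :=
  \sum_(j < n) (gam j)%:C *:
    (lead_coef P *: \prod_(i < n | i != j) ('X - (z i)%:P)).

Definition gen_polar (R : realType) (n : nat) (P : {poly R[i]})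
    (z : 'I_n -> R[i]) (gam : 'I_n -> R) (alpha : R[i]) : {poly R[i]} :=
  (\sum_(j < n) gam j)%:C *: P + (alpha%:P - 'X) * gen_deriv P z gam.

(* The supremum is attained, see [max_circle_attained]. *)
Definition max_circle (R : realType) (P : {poly R[i]}) : R :=
  sup [set normc P.[w] | w in [set w : R[i] | normc w = 1]].

(* [Num.min] has no neutral element; starting the iteration from one of the
   values makes it the minimum of the family, see [min_weightP]. *)
Definition min_weight (R : realType) (n : nat) (n_gt0 : (0 < n)%N)
    (gam : 'I_n -> R) : R :=
  \big[Num.min/gam (Ordinal n_gt0)]_(j < n) gam j.

Lemma gen_derivE (R : realType) (n : nat) (P : {poly R[i]})
    (z : 'I_n -> R[i]) (gam : 'I_n -> R) (w : R[i]) :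
  P = lead_coef P *: \prod_(j < n) ('X - (z j)%:P) ->
  (forall j, w != z j) ->
  (gen_deriv P z gam).[w] = P.[w] * \sum_(j < n) (gam j)%:C / (w - z j).
Proof.
move=> PE wz; rewrite /gen_deriv horner_sum big_distrr /=.
apply: eq_bigr => j _; rewrite [in RHS]PE !hornerZ [in RHS](bigD1 j) //=.
rewrite hornerM hornerXsubC.
have wj : w - z j != 0 by rewrite subr_eq0.
set Q := (X in X.[w]); set c := lead_coef P; set g := _%:C; set q := Q.[w].
rewrite -!mulrA mulrCA; congr (_ * _).
by rewrite [RHS]mulrC -!mulrA mulVf// mulr1 mulrC.
Qed.

Lemma min_weightP (R : realType) (n : nat) (n_gt0 : (0 < n)%N)
    (gam : 'I_n -> R) :
  (exists j, min_weight n_gt0 gam = gam j) /\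
  (forall j, min_weight n_gt0 gam <= gam j).
Proof.
split; last by move=> j; exact: bigmin_le_cond.
rewrite /min_weight; elim/big_ind : _ => [|x y [i ->] [j ->]|i _].
- by exists (Ordinal n_gt0).
- by rewrite minEle; case: ifP => _; [exists i | exists j].
- by exists i.
Qed.

Lemma max_circle_attained (R : realType) (P : {poly R[i]}) :
  exists2 w, normc w = 1 &
    max_circle P = normc P.[w] /\
    forall v, normc v = 1 -> normc P.[v] <= normc P.[w].
Proof.
pose e (t : R) : R[i] := cos t +i* sin t.
have normce t : normc (e t) = 1 by rewrite /= cos2Dsin2 sqrtr1.
have eP v : normc v = 1 -> exists2 t, t \in `[- pi, pi] & v = e t.
  case: v => a b /= nv.
  have ab1 : a ^+ 2 + b ^+ 2 = 1.
    by rewrite -[LHS]sqr_sqrtr ?addr_ge0 ?sqr_ge0// nv expr1n.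
  have a1 : -1 <= a <= 1.
    rewrite -ler_norml -(@ler_pXn2r _ 2)// ?nnegrE//.
    by rewrite real_normK ?num_real// expr1n -ab1 lerDl sqr_ge0.
  have sa : sin (acos a) = `|b|.
    by rewrite sin_acos// -ab1 addrC addKr sqrtr_sqr.
  have a0 := acos_ge0 a1; have api := acos_lepi a1.
  have [b0|b0] := leP 0 b.
    exists (acos a); first by rewrite in_itv/= api andbT (le_trans _ a0)// oppr_le0 pi_ge0.
    by rewrite /e acosK ?in_itv// sa ger0_norm.
  exists (- acos a).
    by rewrite in_itv/= lerN2 api/= (le_trans _ (pi_ge0 R))// oppr_le0.
  by rewrite /e cosN sinN acosK ?in_itv// sa ltr0_norm// opprK.
have [cRe cIm] : continuous (fun t => complex.Re P.[e t]) /\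
                 continuous (fun t => complex.Im P.[e t]).
  elim/poly_ind: P => [|p c [cr ci]].
    by split=> t; under eq_fun do rewrite horner0; exact: cvg_cst.
  have E t : p.[e t] * e t + c =
      (complex.Re p.[e t] * cos t - complex.Im p.[e t] * sin t + complex.Re c)
      +i* (complex.Re p.[e t] * sin t + complex.Im p.[e t] * cos t + complex.Im c).
    by case: (p.[e t]) => x y; case: (c).
  split=> t; under eq_fun do rewrite hornerMXaddC E /=.
    apply: cvgD; last exact: cvg_cst.
    by apply: cvgB; apply: cvgM; [exact: cr|exact: continuous_cos|exact: ci|exact: continuous_sin].
  apply: cvgD; last exact: cvg_cst.
  by apply: cvgD; apply: cvgM; [exact: cr|exact: continuous_sin|exact: ci|exact: continuous_cos].
have cf : continuous (fun t => normc P.[e t]).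
  have -> : (fun t => normc P.[e t]) = (fun t =>
      Num.sqrt (complex.Re P.[e t] ^+ 2 + complex.Im P.[e t] ^+ 2)).
    by apply/funext => t; case: (P.[e t]).
  have ch : continuous (fun t =>
      complex.Re P.[e t] ^+ 2 + complex.Im P.[e t] ^+ 2).
    by move=> t; apply: cvgD; apply: cvgM;
      [exact: cRe|exact: cRe|exact: cIm|exact: cIm].
  move=> t; exact: (continuous_comp (ch t) (@sqrt_continuous _ _)).
have pipi : - pi <= pi :> R by rewrite (le_trans _ (pi_ge0 R))// oppr_le0 pi_ge0.
have [t0 _ t0max] := EVT_max pipi (continuous_subspaceT cf).
have wmax v : normc v = 1 -> normc P.[v] <= normc P.[e t0].
  by move=> /eP[t tpi ->]; exact: t0max.
exists (e t0) => //; split=> //.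
apply/eqP; rewrite eq_le; apply/andP; split.
  apply: ge_sup; first by exists (normc P.[e t0]), (e t0) => //; exact: normce.
  by move=> _ [v /= v1 <-]; exact: wmax.
apply: ub_le_sup; last by exists (e t0) => //; exact: normce.
by exists (normc P.[e t0]) => _ [v /= v1 <-]; exact: wmax.
Qed.

(* Main.v *)
Require Import Defs.
From mathcomp Require Import zify ring lra.
Local Open Scope ring_scope.
Local Open Scope complex_scope.

(** Write M_r(Q) for the maximum of |Q| on the circle |z| = r and D for the
    generalized polar derivative of P. The estimate is natural on |z| = k, a
    circle enclosing all the zeros, and is then carried back to |z| = 1.

    On |z| = k, put T = \sum_j gam_j z / (z - z_j), so that
    z D(z) = P(z) (z (Lambda - T) + alpha T). Each quotient z / (z - z_j) has
    real part at least k / (k + |z_j|) >= 1/2 ([Re_div_ge]); hence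
    Re T >= Lambda / 2, that is |Lambda - T| <= |T|, and therefore
    k |D(z)| >= (|alpha| - k) (Re T) |P(z)|. Since
    k / (k + r) = 1/2 + 1/2 (1 - r/k) / (1 + r/k), the refinement of the bound
    Re T >= Lambda / 2 is a sum of terms (1 - a_j) / (1 + a_j), with
    a_j = |z_j| / k in [0, 1], which is at least the same expression in the
    product of the a_j ([sum_cayley_ge]); this product is |a_0| / (k^n |a_n|).
    This gives [gen_polar_circle_ge].

    Two comparisons lead back to the unit circle. The leading terms of
    Lambda P and z P^gamma cancel, so D has degree at most n - 1 and
    M_k(D) <= k^(n-1) M_1(D) ([size_gen_polar], [max_modulus_growth]). For P
    itself, whose zeros lie in |z| <= k, the required inequality
    2 k^n M_1(P) <= (1 + k^n) M_k(P) is the Ankeny-Rivlin theorem for the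
    reciprocal polynomial ([roots_in_disc_growth]). It is obtained here by
    comparing the values at v and k^2 v, with |v| = 1: these two points are
    exchanged by the inversion in the circle |z| = k, so that
    |k^2 v - w| / (k |v - w|) is at least 1 or at most 1 according to the side
    of the circle where w lies ([sqr_dist_dilate]).

    All this rests on the maximum modulus principle for polynomials, proved
    without integration in [max_modulus]. *)

Section Bounds.
Set Implicit Arguments.
Unset Strict Implicit.
Variable R : realType.
Implicit Types (x y w u v : R[i]) (p q : {poly R[i]}) (M k : R) (s : seq R[i]).

(** * The complex modulus *)

Lemma normc_ge0 x : 0 <= normc x.
Proof. by case: x => a b; exact: sqrtr_ge0. Qed.

Lemma sqr_normcE x : normc x ^+ 2 = complex.Re x ^+ 2 + complex.Im x ^+ 2.
Proof. by case: x => a b /=; rewrite sqr_sqrtr// addr_ge0 ?sqr_ge0. Qed.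

Lemma normc_triangle x y : normc (x + y) <= normc x + normc y.
Proof. exact: le_normcD. Qed.

Lemma normc_opp x : normc (- x) = normc x.
Proof. exact: normcN. Qed.

Lemma normc_sub_ge x y : normc x - normc y <= normc (x - y).
Proof. by rewrite lerBlDr -[X in normc X <= _](subrK y) normc_triangle. Qed.

Lemma normc_real (a : R) : 0 <= a -> normc a%:C = a.
Proof. by move=> a0 /=; rewrite expr0n/= addr0 sqrtr_sqr ger0_norm. Qed.

Lemma normcX x m : normc (x ^+ m) = normc x ^+ m.
Proof.
by elim: m => [|m IH]; rewrite ?expr0 ?normc1// !exprS normcM IH.
Qed.

Lemma normc_prod (I : Type) (r : seq I) (Q : pred I) (F : I -> R[i]) :
  normc (\prod_(i <- r | Q i) F i) = \prod_(i <- r | Q i) normc (F i).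
Proof.
apply: (big_morph (@normc R)) => [x y|]; [exact: normcM|exact: normc1].
Qed.

Lemma normc_sum (I : Type) (r : seq I) (Q : pred I) (F : I -> R[i]) :
  normc (\sum_(i <- r | Q i) F i) <= \sum_(i <- r | Q i) normc (F i).
Proof.
elim/big_ind2: _ => [|a b c d ab cd|//]; first by rewrite normc0.
by rewrite (le_trans (normc_triangle _ _))// lerD.
Qed.

Lemma Re_le_normc x : complex.Re x <= normc x.
Proof.
apply: le_trans (ler_norm _) _.
rewrite -(@ler_pXn2r _ 2) ?nnegrE ?normc_ge0// real_normK ?num_real//.
by rewrite sqr_normcE lerDl sqr_ge0.
Qed.

Lemma Re_scale (a : R) x : complex.Re (a%:C * x) = a * complex.Re x.
Proof. by case: x => b c /=; rewrite mul0r subr0. Qed.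

Lemma normc_polar x : exists2 u, normc u = 1 & x = (normc x)%:C * u.
Proof.
have [->|x0] := eqVneq x 0.
  by exists 1; rewrite ?normc1// normc0 mul0r.
have nx0 : normc x != 0 by apply: contra_neq x0 => /eq0_normc.
exists ((normc x)%:C^-1 * x).
  by rewrite normcM normcV normc_real ?normc_ge0// mulVf.
rewrite mulVKf//; apply: contra_neq nx0 => /(congr1 (@normc R)).
by rewrite normc_real ?normc_ge0// normc0.
Qed.

(** * The maximum modulus principle for polynomials *)

(** If |q| <= M on the unit circle, then the even part (q(s) + q(-s)) / 2 =
    e(s^2) and the odd part (q(s) - q(-s)) / 2 = s o(s^2) satisfy the same
    bound, and every point of the circle is such a square s^2: the bound passes
    to e and o, which have about half the degree and carry the coefficients of
    q. Induction on the degree replaces the Cauchy integral. *)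
Lemma coef_le_circle q M :
  (forall w, normc w = 1 -> normc q.[w] <= M) -> forall i, normc q`_i <= M.
Proof.
have [m] := ubnP (size q); elim: m q => // m IH q szq qM i.
have [sz1|sz1] := leqP (size q) 1.
  have := qM 1 (normc1 R); rewrite (size1_polyC sz1) hornerC coefC => q0.
  by case: (i == 0%N) => //; rewrite normc0 (le_trans (normc_ge0 _) q0).
have eo w : normc w = 1 -> exists2 s : R[i], normc s = 1 &
   q.[s] = (even_poly q).[w] + (odd_poly q).[w] * s /\
   q.[- s] = (even_poly q).[w] - (odd_poly q).[w] * s.
  move=> w1; exists (sqrtC w).
    apply/eqP; rewrite -(@eqrXn2 _ 2) ?normc_ge0//.
    by rewrite -normcX sqrtCK w1 expr1n.
  split; rewrite -{1}(poly_even_odd q) hornerD hornerM !horner_comp hornerXn hornerX.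
    by rewrite sqrtCK.
  by rewrite sqrrN sqrtCK mulrN.
have n2 : normc (2%:R : R[i]) = 2 :> R.
  by rewrite (_ : 2%:R = (2 : R)%:C) ?normc_real// rmorph_nat.
have half (x y X : R[i]) : 2%:R * X = x + y -> normc x <= M -> normc y <= M ->
    normc X <= M.
  move=> E xM yM; have := normc_triangle x y.
  by rewrite -E normcM n2 => h; lra.
have hN (s : R[i]) : normc s = 1 -> normc (- s) = 1 by rewrite normc_opp.
have szu : (uphalf (size q) < m)%N by move: szq sz1; case: (size q) => [|[|l]]//; lia.
rewrite -(odd_double_half i); case: (odd i) => /=.
  rewrite add1n -coef_odd_poly; apply: IH.
    by rewrite (leq_ltn_trans (size_odd_poly q))// (leq_ltn_trans _ szu)// uphalf_half leq_addl.
  move=> w /eo[s s1 [es eN]].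
  have -> : normc (odd_poly q).[w] = normc ((odd_poly q).[w] * s) by rewrite normcM s1 mulr1.
  apply: (half q.[s] (- q.[- s])); rewrite ?normc_opp ?qM ?hN//.
  by rewrite es eN; ring.
rewrite add0n -coef_even_poly; apply: IH.
  exact: leq_ltn_trans (size_even_poly q) szu.
move=> w /eo[s s1 [es eN]].
apply: (half q.[s] q.[- s]); rewrite ?qM ?hN//.
by rewrite es eN; ring.
Qed.

Lemma disc_le_size q M u :
  (forall w, normc w = 1 -> normc q.[w] <= M) -> normc u <= 1 ->
  normc q.[u] <= (size q)%:R * M.
Proof.
move=> qM u1; rewrite horner_coef (le_trans (normc_sum _ _ _))//.
rewrite mulr_natl -[X in M *+ X]card_ord -sumr_const ler_sum// => i _.
rewrite normcM normcX -[leRHS]mulr1 ler_pM ?exprn_ge0 ?normc_ge0//.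
  exact: coef_le_circle.
by rewrite exprn_ile1 ?normc_ge0.
Qed.

(** A factor growing linearly in m cannot compensate for an exponential gap: if
    x / M = 1 + h with h > 0, then (1 + h)^(2j) >= (1 + j h)^2 is quadratic in
    j. *)
Lemma le_of_expr_le (x M : R) (n : nat) : 0 <= x -> 0 <= M ->
  (forall m, x ^+ m <= (n * m).+1%:R * M ^+ m) -> x <= M.
Proof.
move=> x0 M0 H; rewrite leNgt; apply/negP => Mx.
(* If M = 0, the exponent 1 already forces x <= 0. *)
have {M0} M0 : 0 < M.
  rewrite lt0r M0 andbT; apply/eqP => M0'.
  by have := H 1%N; rewrite M0' expr1 mulr0 -M0' leNgt Mx.
pose h := x / M - 1.
have h0 : 0 < h by rewrite subr_gt0 ltr_pdivlMr// mul1r.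
have hm m : (1 + h) ^+ m <= (n * m).+1%:R.
  have -> : 1 + h = x / M by rewrite addrC subrK.
  by rewrite expr_div_n ler_pdivrMr ?exprn_gt0.
have bern j : 1 + j%:R * h <= (1 + h) ^+ j.
  elim: j => [|j IH]; first by rewrite mul0r addr0 expr0.
  rewrite exprS; apply: le_trans (ler_wpM2l (addr_ge0 ler01 (ltW h0)) IH).
  have : 0 <= j%:R * h * h by rewrite !mulr_ge0// ltW.
  rewrite -natr1; lra.
(* A threshold for j^2 h^2 > 2 j n. *)
pose j := Num.bound (2 * n%:R / h ^+ 2).
have jP : 2 * n%:R / h ^+ 2 < j%:R.
  have := archi_boundP (_ : 0 <= 2 * n%:R / h ^+ 2); apply.
  by rewrite !mulr_ge0 ?invr_ge0 ?sqr_ge0.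
rewrite ltr_pdivrMr ?exprn_gt0// in jP.
have := hm (j * 2)%N; rewrite exprM leNgt => /negP; apply.
have jh : 0 <= j%:R * h by rewrite mulr_ge0// ltW.
apply: (@lt_le_trans _ _ ((1 + j%:R * h) ^+ 2)).
  2: by have h1 : 0 <= 1 + h; [lra|apply: lerXn2r (bern j); rewrite ?nnegrE ?exprn_ge0// addr_ge0].
have jj : 0 <= (j%:R : R) by [].
have j1 : 0 < (j%:R : R).
  rewrite lt0r jj andbT; apply/eqP => j0; move: jP; rewrite j0 mul0r ltNge.
  by rewrite mulr_ge0.
rewrite -natr1 !natrM; move: jP jh j1; set J := j%:R; set N := n%:R => jP jh j1.
have : 0 < J * (J * h ^+ 2 - 2 * N) by rewrite mulr_gt0// subr_gt0.
lra.
Qed.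

(** The bound on the coefficients only yields |q(u)| <= (size q) M on the disc.
    Applied to the powers of q, whose sizes grow linearly in the exponent, it
    loses nothing in the limit. *)
Lemma max_modulus q M u :
  (forall w, normc w = 1 -> normc q.[w] <= M) -> normc u <= 1 ->
  normc q.[u] <= M.
Proof.
move=> qM u1.
have M0 : 0 <= M by rewrite (le_trans (normc_ge0 _) (qM 1 (normc1 R))).
apply: (@le_of_expr_le _ _ (size q).-1) => // [|m]; first exact: normc_ge0.
have mM w : normc w = 1 -> normc (q ^+ m).[w] <= M ^+ m.
  by move=> w1; rewrite horner_exp normcX lerXn2r ?nnegrE ?normc_ge0 ?qM.
rewrite -normcX -horner_exp (le_trans (disc_le_size mM u1))//.
by rewrite ler_wpM2r ?exprn_ge0// ler_nat size_poly_exp_leq.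
Qed.

(** The maximum modulus principle for the reversed polynomial
    X^m q(1/X), evaluated at 1/z. *)
Lemma max_modulus_growth q M k m (z : R[i]) : (size q <= m.+1)%N -> 1 <= k ->
  (forall w, normc w = 1 -> normc q.[w] <= M) -> normc z = k ->
  normc q.[z] <= k ^+ m * M.
Proof.
move=> sq k1 qM zk.
have z_neq0 (x : R[i]) : 0 < normc x -> x != 0.
  by move=> h; apply/eqP => x0; move: h; rewrite x0 normc0 ltxx.
pose r := \poly_(i < m.+1) q`_(m - i).
have rE (x : R[i]) : x != 0 -> q.[x] = x ^+ m * r.[x^-1].
  move=> x0; rewrite (horner_coef_wide _ sq) horner_poly mulr_sumr.
  rewrite (reindex_inj rev_ord_inj)/=; apply: eq_bigr => i _.
  rewrite subSS mulrCA; congr (_ * _).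
  by rewrite exprVn -exprB ?unitfE ?leq_ord.
rewrite rE; last by rewrite z_neq0// zk; lra.
rewrite normcM normcX zk ler_wpM2l//; first by rewrite exprn_ge0//; lra.
apply: max_modulus => [w w1|]; last by rewrite normcV zk invf_le1//; lra.
have w0 : w^-1 != 0 by rewrite z_neq0// normcV w1 invr1.
have := qM w^-1; rewrite normcV w1 invr1 => /(_ erefl).
by rewrite rE// normcM normcX normcV w1 invr1 expr1n mul1r invrK.
Qed.

Lemma max_modulus_radius q M k u : 0 < k ->
  (forall w, normc w = k -> normc q.[w] <= M) -> normc u <= k ->
  normc q.[u] <= M.
Proof.
move=> k0 qM uk.
have kC x : (q \Po (k%:C *: 'X)).[x] = q.[k%:C * x].
  by rewrite horner_comp hornerZ hornerX.
have kC0 : k%:C != 0 :> R[i].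
  by apply/eqP => /(congr1 (@normc R)); rewrite normc_real ?ltW// normc0; lra.
have <- : k%:C * (k%:C^-1 * u) = u by rewrite mulVKf.
rewrite -kC; apply: max_modulus => [w w1|].
  by rewrite kC qM// normcM w1 normc_real ?ltW// mulr1.
by rewrite normcM normcV normc_real ?(ltW k0)// ler_pdivrMl// mulr1.
Qed.

(** * Growth of a polynomial with all its zeros in a disc *)

(** For |v| = 1 and k > 1 the points v and k^2 v are inverse to each other in
    the circle |z| = k, which is an Apollonius circle of this pair: the distance
    from w to k^2 v is k times the distance from w to v exactly on this
    circle. *)
Lemma sqr_dist_dilate v w k : normc v = 1 ->
  normc (k%:C ^+ 2 * v - w) ^+ 2 - (k * normc (v - w)) ^+ 2 =
  (k ^+ 2 - 1) * (k ^+ 2 - normc w ^+ 2).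
Proof.
move=> v1; rewrite -rmorphXn; have := sqr_normcE v; rewrite v1 expr1n exprMn !sqr_normcE.
case: v {v1} => a b; case: w => c d /= ab.
have E : k ^+ 2 = k ^+ 2 * (a ^+ 2 + b ^+ 2) by rewrite -ab mulr1.
rewrite [X in _ = _ * (X - _)]E.
ring.
Qed.

Lemma dist_dilate_ge v w k : 1 <= k -> normc v = 1 -> normc w <= k ->
  k * normc (v - w) <= normc (k%:C ^+ 2 * v - w).
Proof.
move=> k1 v1 wk; have k0 : 0 <= k by lra.
rewrite -(@ler_pXn2r _ 2) ?nnegrE ?mulr_ge0 ?normc_ge0// -subr_ge0.
rewrite sqr_dist_dilate// mulr_ge0// subr_ge0 ?exprn_ege1//.
by rewrite lerXn2r ?nnegrE ?normc_ge0.
Qed.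

Lemma dist_dilate_le v w k : 1 <= k -> normc v = 1 -> k <= normc w ->
  normc (k%:C ^+ 2 * v - w) <= k * normc (v - w).
Proof.
move=> k1 v1 wk; have k0 : 0 <= k by lra.
rewrite -(@ler_pXn2r _ 2) ?nnegrE ?mulr_ge0 ?normc_ge0// -subr_le0.
rewrite sqr_dist_dilate// mulr_ge0_le0// ?subr_ge0 ?exprn_ege1// subr_le0.
by rewrite lerXn2r ?nnegrE ?normc_ge0.
Qed.

Lemma normc_horner_roots (c : R[i]) s x :
  normc (c *: \prod_(w <- s) ('X - w%:P)).[x] =
  normc c * \prod_(w <- s) normc (x - w).
Proof.
rewrite hornerZ normcM horner_prod normc_prod; congr (_ * _).
by apply: eq_bigr => w _; rewrite hornerXsubC.
Qed.

Lemma dilate_ge c s v k : 1 <= k -> normc v = 1 ->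
  (forall w, w \in s -> normc w <= k) ->
  let p := c *: \prod_(w <- s) ('X - w%:P) in
  k ^+ size s * normc p.[v] <= normc p.[k%:C ^+ 2 * v].
Proof.
move=> k1 v1 sk /=; rewrite !normc_horner_roots mulrCA ler_wpM2l ?normc_ge0//.
elim: s sk => [|w s IH] sk; first by rewrite !big_nil mulr1.
rewrite !big_cons /= [k ^+ _]exprS mulrACA ler_pM ?mulr_ge0 ?exprn_ge0 ?normc_ge0 ?prodr_ge0//; try lra.
- by move=> *; exact: normc_ge0.
- by rewrite dist_dilate_ge// sk// mem_head.
- by apply: IH => x xs; rewrite sk// in_cons xs orbT.
Qed.

Lemma dilate_le c s v k : 1 <= k -> normc v = 1 ->
  (forall w, w \in s -> k <= normc w) ->
  let p := c *: \prod_(w <- s) ('X - w%:P) in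
  normc p.[k%:C ^+ 2 * v] <= k ^+ size s * normc p.[v].
Proof.
move=> k1 v1 sk /=; rewrite !normc_horner_roots mulrCA ler_wpM2l ?normc_ge0//.
elim: s sk => [|w s IH] sk; first by rewrite !big_nil mulr1.
rewrite !big_cons /= [k ^+ _]exprS mulrACA ler_pM ?normc_ge0 ?prodr_ge0//.
- by move=> *; exact: normc_ge0.
- by rewrite dist_dilate_le// sk// mem_head.
- by apply: IH => x xs; rewrite sk// in_cons xs orbT.
Qed.

(** Let u be the phase of p(v) and L > M. Then F = p - L u has no zero in
    |z| < k, because |p| <= M there, so [dilate_le] gives
    |F(k^2 v)| <= k^n |F(v)|, where |F(v)| = L - |p(v)| by the choice of u and
    |F(k^2 v)| >= |p(k^2 v)| - L. Then L tends to M. *)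
Lemma dilate_sum_le p n M k v : 1 <= k -> (size p <= n.+1)%N ->
  (forall w, normc w = k -> normc p.[w] <= M) -> normc v = 1 ->
  normc p.[k%:C ^+ 2 * v] + k ^+ n * normc p.[v] <= (1 + k ^+ n) * M.
Proof.
move=> k1 sp pM v1; have k0 : 0 < k by lra.
have kn : 1 <= k ^+ n by rewrite exprn_ege1.
apply/ler_addgt0Pr => e e0.
(* This L turns the final bound (1 + k^n) L into (1 + k^n) M + e. *)
pose L := M + e / (1 + k ^+ n).
have ML : M < L by rewrite ltrDl divr_gt0//; lra.
have -> : (1 + k ^+ n) * M + e = (1 + k ^+ n) * L.
  by rewrite mulrDr mulrCA divff ?mulr1//; apply/eqP; lra.
have M0 : 0 <= M.
  by apply: le_trans (normc_ge0 _) (pM k%:C _); rewrite normc_real ?ltW.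
have [u u1 pu] := normc_polar p.[v].
have Lu : normc (L%:C * u) = L by rewrite normcM u1 mulr1 normc_real; lra.
pose F := p - (L%:C * u)%:P.
have FE x : F.[x] = p.[x] - L%:C * u by rewrite hornerD hornerN hornerC.
have F0 x : normc x < k -> F.[x] != 0.
  move=> xk; rewrite FE; apply/eqP => /subr0_eq px.
  have := max_modulus_radius k0 pM (ltW xk); rewrite px Lu; lra.
have Fn0 : F != 0.
  by apply: contraTneq (F0 0 _) => [->|]; rewrite ?horner0 ?eqxx// normc0.
have [r Fr] := closed_field_poly_normal F.
(* F may have fewer than n zeros, which is harmless as k >= 1. *)
have szr : (size r <= n)%N.
  rewrite -ltnS; have <- : size F = (size r).+1.
    by rewrite Fr size_scale ?lead_coef_eq0// size_prod_XsubC.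
  rewrite (leq_trans (size_polyD _ _))// size_polyN geq_max sp.
  by rewrite (leq_trans (size_polyC_leq1 _)).
have rk w : w \in r -> k <= normc w.
  move=> wr; rewrite leNgt; apply/negP => /F0.
  by rewrite -[_ == 0]/(root F w) Fr rootZ ?lead_coef_eq0// root_prod_XsubC wr.
have := dilate_le (lead_coef F) k1 v1 rk; rewrite /= -Fr.
have -> : normc F.[v] = L - normc p.[v].
  rewrite FE {1}pu -mulrBl normcM u1 mulr1 -rmorphB -normc_opp -rmorphN.
  rewrite normc_real opprB// subr_ge0.
  by rewrite (le_trans (max_modulus_radius k0 pM _))// ?v1// ltW.
have := normc_sub_ge p.[k%:C ^+ 2 * v] (L%:C * u); rewrite -FE Lu.
have pvL : 0 <= L - normc p.[v].
  by rewrite subr_ge0 (le_trans (max_modulus_radius k0 pM _))// ?v1// ltW.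
have := ler_wpM2r pvL (ler_weXn2l k1 szr).
lra.
Qed.

(** When the zeros lie in |z| <= k, the term |p(k^2 v)| in [dilate_sum_le] is
    itself at least k^n |p(v)|. *)
Lemma roots_in_disc_growth c s v M k : 1 <= k ->
  (forall w, w \in s -> normc w <= k) ->
  let p := c *: \prod_(w <- s) ('X - w%:P) in
  (forall w, normc w = k -> normc p.[w] <= M) -> normc v = 1 ->
  2 * k ^+ size s * normc p.[v] <= (1 + k ^+ size s) * M.
Proof.
move=> k1 sk p pM v1.
have szp : (size p <= (size s).+1)%N.
  by rewrite (leq_trans (size_scale_leq _ _))// size_prod_XsubC.
have := dilate_sum_le k1 szp pM v1; have := dilate_ge c k1 v1 sk.
rewrite /= -/p; lra.
Qed.

(** * The polar derivative on a circle enclosing the zeros *)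

(** Put x = a + i b, w = c + i d and X = ac + bd, the scalar product of x and
    w. Then Re (x / (x - w)) = (k^2 - X) / (k^2 + r^2 - 2 X) with r = |w|, and
    after cross-multiplication the claim becomes (k - r) (k r + X) >= 0, which
    is the Cauchy-Schwarz inequality. *)
Lemma Re_div_ge k x w : 0 < k -> normc x = k -> normc w <= k -> x != w ->
  k / (k + normc w) <= complex.Re (x / (x - w)).
Proof.
move=> k0 xk wk xw; have r0 := normc_ge0 w.
have d0 : x - w != 0 by rewrite subr_eq0.
have := normc_sub_ge x (- w); rewrite opprK normc_opp xk => h.
have {h} h : (k - normc w) ^+ 2 <= normc (x + w) ^+ 2.
  by rewrite lerXn2r ?nnegrE ?normc_ge0// subr_ge0.
have D0 : 0 < normc (x - w) ^+ 2.
  rewrite exprn_gt0// lt0r normc_ge0 andbT; apply: contra_neq d0.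
  exact: eq0_normc.
have qE := divfK d0 x; set q := x / (x - w) in qE *.
rewrite sqr_normcE in D0; rewrite [leRHS]sqr_normcE in h.
move: h D0 qE; have := sqr_normcE x; rewrite xk; have := sqr_normcE w.
move: (normc w) wk r0 => r rk r0; case: q => s t.
case: x {xk xw d0} => a b; case: w => c d /= E1 E2 h D0 [Ea Eb].
rewrite ler_pdivrMr; last by lra.
have sD : s * ((a - c) ^+ 2 + (b - d) ^+ 2) = a * (a - c) + b * (b - d).
  transitivity ((s * (a - c) - t * (b - d)) * (a - c) +
                (s * (b - d) + t * (a - c)) * (b - d)); first by ring.
  by rewrite Ea Eb.
rewrite -(ler_pM2l D0) (_ : _ * (s * _) =
   (s * ((a - c) ^+ 2 + (b - d) ^+ 2)) * (k + r)); last by ring.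
rewrite sD -subr_ge0.
have X0 : 0 <= k * r + (a * c + b * d) by lra.
rewrite (_ : _ - _ = (k - r) * (k * r + (a * c + b * d))).
  by rewrite mulr_ge0// subr_ge0.
have D : (a - c) ^+ 2 + (b - d) ^+ 2 = k ^+ 2 + r ^+ 2 - 2 * (a * c + b * d).
  by rewrite E1 E2; ring.
have N : a * (a - c) + b * (b - d) = k ^+ 2 - (a * c + b * d).
  by rewrite E2; ring.
by rewrite D N; ring.
Qed.

(** With f(a) = (1 - a) / (1 + a), the two-term case f(b) + f(p) >= f(b p)
    amounts to (1 - b p) (1 - b) (1 - p) >= 0. *)
Lemma sum_cayley_ge (I : Type) (r : seq I) (a : I -> R) :
  (forall i, 0 <= a i <= 1) ->
  (1 - \prod_(i <- r) a i) / (1 + \prod_(i <- r) a i) <=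
  \sum_(i <- r) (1 - a i) / (1 + a i).
Proof.
move=> a01.
suff : 0 <= \prod_(i <- r) a i <= 1 /\
  (1 - \prod_(i <- r) a i) / (1 + \prod_(i <- r) a i) <=
  \sum_(i <- r) (1 - a i) / (1 + a i) by case.
elim/big_rec2: _ => [|i s p _ [/andP[p0 p1] ps]].
  by rewrite ler01 lexx subrr mul0r.
have /andP[a0 a1] := a01 i; set b := a i in a0 a1 *.
have bp : 0 <= b * p by rewrite mulr_ge0.
split; first by rewrite bp mulr_ile1.
apply: le_trans (lerD (lexx _) ps).
have -> : (1 - b) / (1 + b) + (1 - p) / (1 + p) =
   2 * (1 - b * p) / ((1 + b) * (1 + p)) by field; lra.
rewrite ler_pdivlMr ?mulr_gt0//; try lra.
rewrite mulrAC ler_pdivrMr; last lra.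
have : 0 <= (1 - b * p) * ((1 - b) * (1 - p)).
  by rewrite !mulr_ge0// subr_ge0// mulr_ile1.
lra.
Qed.

(** Each k / (k + r_j) is 1/2 + 1/2 f(r_j / k), with f(a) = (1 - a) / (1 + a)
    nonnegative on [0, 1]; in front of f the weights may thus be lowered to
    their minimum before [sum_cayley_ge] is applied. *)
Lemma weighted_sum_ge (n : nat) (n_gt0 : (0 < n)%N) (k : R) (gam r : 'I_n -> R) :
  0 < k -> (forall j, 0 <= r j <= k) -> (forall j, 0 <= gam j) ->
  (\sum_j gam j + min_weight n_gt0 gam *
     ((k ^+ n - \prod_j r j) / (k ^+ n + \prod_j r j))) / 2 <=
  \sum_j gam j * (k / (k + r j)).
Proof.
move=> k0 rk g0; have [[m gm] gmin] := min_weightP n_gt0 gam.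
have r01 j : 0 <= r j / k <= 1.
  by have /andP[r0 rjk] := rk j; rewrite divr_ge0 ?(ltW k0)//= ler_pdivrMr// mul1r.
have kn0 : 0 < k ^+ n by rewrite exprn_gt0.
have pr0 : 0 <= \prod_j r j by apply: prodr_ge0 => j _; case/andP: (rk j).
have -> : (k ^+ n - \prod_j r j) / (k ^+ n + \prod_j r j) =
    (1 - \prod_j (r j / k)) / (1 + \prod_j (r j / k)).
  rewrite big_split/= prodr_const card_ord exprVn.
  by field; rewrite !gt_eqF//; lra.
have /(ler_wpM2l (_ : 0 <= min_weight n_gt0 gam)) := sum_cayley_ge (index_enum _) r01.
rewrite {1}gm => /(_ (g0 m)) H.
apply: (@le_trans _ _ ((\sum_j gam j + \sum_j gam j * ((1 - r j / k) / (1 + r j / k))) / 2)).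
  rewrite ler_pM2r ?invr_gt0// lerD2l (le_trans H)// mulr_sumr ler_sum// => j _.
  rewrite ler_wpM2r//; have := r01 j => /andP[q0 q1].
  by rewrite divr_ge0//; lra.
rewrite -big_split/= mulr_suml ler_sum// => j _.
have /andP[r0 _] := rk j.
rewrite le_eqVlt; apply/orP; left; apply/eqP; field.
by rewrite !gt_eqF//; lra.
Qed.

(** Since P = (X - z_j) P_j, each summand gam_j (P + (alpha - X) P_j) is
    gam_j (alpha - z_j) P_j; the cancellation of the leading terms of the polar
    derivative is thereby explicit. *)
Lemma gen_polar_sum (n : nat) (P : {poly R[i]}) (z : 'I_n -> R[i])
    (gam : 'I_n -> R) (alpha : R[i]) :
  P = lead_coef P *: \prod_(j < n) ('X - (z j)%:P) ->
  gen_polar P z gam alpha = \sum_(j < n) ((gam j)%:C * (alpha - z j)) *: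
    (lead_coef P *: \prod_(i < n | i != j) ('X - (z i)%:P)).
Proof.
move=> PE; rewrite /gen_polar /gen_deriv raddf_sum scaler_suml mulr_sumr.
rewrite -big_split/=; apply: eq_bigr => j _.
rewrite [in X in X + _]PE (bigD1 j)//= -!mul_polyC rmorphM rmorphB/=.
by set Q := \prod_(i < n | _) _; ring.
Qed.

Lemma size_gen_polar (n : nat) (P : {poly R[i]}) (z : 'I_n -> R[i])
    (gam : 'I_n -> R) (alpha : R[i]) :
  P = lead_coef P *: \prod_(j < n) ('X - (z j)%:P) ->
  (size (gen_polar P z gam alpha) <= n)%N.
Proof.
move=> PE; rewrite (gen_polar_sum _ _ PE).
apply: (leq_trans (size_sum _ _ _)); apply/bigmax_leqP => j _.
rewrite scalerA (leq_trans (size_scale_leq _ _))//.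
rewrite -(big_enum _ _ (predC1 j) (fun i => 'X - (z i)%:P)) size_prod_XsubC -cardE cardC1 card_ord.
by case: n j {P z gam PE} => [[]|].
Qed.

(** The bound on the circle |w| = k. It is trivial at a zero of P; elsewhere
    w D(w) = P(w) (alpha T - w (T - Lambda)), and Re T >= Lambda / 2 means that
    T is at least as far from 0 as from Lambda. *)
Lemma gen_polar_circle_ge (n : nat) (n_gt0 : (0 < n)%N) (k : R)
    (P : {poly R[i]}) (z : 'I_n -> R[i]) (gam : 'I_n -> R) (alpha w : R[i]) :
  0 < k -> P = lead_coef P *: \prod_(j < n) ('X - (z j)%:P) ->
  (forall j, normc (z j) <= k) -> (forall j, 0 <= gam j) ->
  k <= normc alpha -> normc w = k ->
  (normc alpha - k) *
    ((\sum_j gam j + min_weight n_gt0 gam *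
     ((k ^+ n - \prod_j normc (z j)) / (k ^+ n + \prod_j normc (z j)))) / 2) *
   normc P.[w]
  <= k * normc (gen_polar P z gam alpha).[w].
Proof.
move=> k0 PE zk g0 ak wk.
have [Pw0|Pw0] := eqVneq P.[w] 0.
  by rewrite Pw0 normc0 mulr0 mulr_ge0 ?(ltW k0)// normc_ge0.
have wz j : w != z j.
  apply: contra_neq Pw0 => ->.
  by rewrite PE hornerZ horner_prod (bigD1 j)//= hornerXsubC subrr mul0r mulr0.
have rk j : 0 <= normc (z j) <= k by rewrite normc_ge0 zk.
pose T := \sum_j (gam j)%:C * (w / (w - z j)).
have ReT : \sum_j gam j * (k / (k + normc (z j))) <= complex.Re T.
  have -> : complex.Re T = \sum_j gam j * complex.Re (w / (w - z j)).
    by rewrite /T raddf_sum; apply: eq_bigr => j _; exact: Re_scale.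
  by apply: ler_sum => j _; rewrite ler_wpM2l// Re_div_ge.
have half : (\sum_j gam j) / 2 <= \sum_j gam j * (k / (k + normc (z j))).
  rewrite mulr_suml ler_sum// => j _; rewrite ler_wpM2l//.
  have /andP[r0 r1] := rk j; rewrite ler_pdivlMr; lra.
have TL : normc ((\sum_j gam j)%:C - T) <= normc T.
  rewrite -(@ler_pXn2r _ 2) ?nnegrE ?normc_ge0// !sqr_normcE.
  have L0 : 0 <= \sum_j gam j by apply: sumr_ge0.
  have : 0 <= (\sum_j gam j) * (complex.Re T - (\sum_j gam j) / 2).
    by rewrite mulr_ge0// subr_ge0 (le_trans half).
  move: (\sum_j gam j) => L; case: T {ReT} => a b /=; rewrite sub0r; lra.
have E : w * (gen_polar P z gam alpha).[w] =
    P.[w] * (alpha * T - w * (T - (\sum_j gam j)%:C)).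
  have -> : T = w * \sum_j (gam j)%:C / (w - z j).
    by rewrite /T mulr_sumr; apply: eq_bigr => j _; ring.
  rewrite /gen_polar hornerD hornerZ hornerM hornerD hornerN hornerC hornerX.
  by rewrite (gen_derivE _ PE)//; ring.
rewrite -[X in _ <= X * _]wk -normcM E normcM mulrC ler_wpM2l ?normc_ge0//.
apply: le_trans (normc_sub_ge _ _).
rewrite !normcM wk -(normc_opp (T - _)) opprB.
have W := le_trans (weighted_sum_ge n_gt0 k0 rk g0) (le_trans ReT (Re_le_normc T)).
have := ler_wpM2l (ltW k0) TL.
have := ler_wpM2l (_ : 0 <= normc alpha - k) W; rewrite subr_ge0 => /(_ ak).
lra.
Qed.

End Bounds.

(** * From the circle |z| = k back to the unit circle *)

Theorem theorem2 (R : realType) (k : R) (n : nat) (n_gt0 : (0 < n)%N)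
    (P : {poly R[i]}) (z : 'I_n -> R[i]) (gam : 'I_n -> R) (alpha : R[i])
    (k_ge1 : 1 <= k)
    (sizeP : size P = n.+1)
    (PE : P = P`_n *: \prod_(j < n) ('X - (z j)%:P))
    (z_le : forall j, normc (z j) <= k)
    (gam_ge0 : forall j, 0 <= gam j)
    (gam_neq0 : exists j, gam j != 0)
    (alpha_ge : k <= normc alpha) :
  max_circle (gen_polar P z gam alpha) >=
    (normc alpha - k) / (1 + k ^+ n) *
    (\sum_(j < n) gam j +
       min_weight n_gt0 gam *
         ((k ^+ n * normc P`_n - normc P`_0) /
          (k ^+ n * normc P`_n + normc P`_0))) *
    max_circle P.
Proof.
have k0 : 0 < k by lra.
have kn0 : 0 < k ^+ n by rewrite exprn_gt0.
have lcP : lead_coef P = P`_n by rewrite lead_coefE sizeP.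
have PE' : P = lead_coef P *: \prod_(j < n) ('X - (z j)%:P) by rewrite lcP.
have prod0 : 0 <= \prod_j normc (z j).
  by apply: prodr_ge0 => j _; exact: normc_ge0.
have an0 : 0 < normc P`_n.
  rewrite lt0r normc_ge0 andbT -lcP; apply/eqP => /eq0_normc/eqP.
  by rewrite lead_coef_eq0 -size_poly_eq0 sizeP.
have P0 : normc P`_0 = normc P`_n * \prod_j normc (z j).
  rewrite -horner_coef0 {1}PE hornerZ normcM horner_prod normc_prod.
  by congr (_ * _); apply: eq_bigr => j _; rewrite hornerXsubC sub0r normc_opp.
have -> : (k ^+ n * normc P`_n - normc P`_0) / (k ^+ n * normc P`_n + normc P`_0)
   = (k ^+ n - \prod_j normc (z j)) / (k ^+ n + \prod_j normc (z j)).
  by rewrite P0 [k ^+ n * _]mulrC -mulrBr -mulrDr -mulf_div divff ?mul1r ?gt_eqF.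
set H := \sum_j _ + _.
have [v0 v01 [-> _]] := max_circle_attained P.
have [w0 _ [-> DM]] := max_circle_attained (gen_polar P z gam alpha).
set M1 := normc _.[w0] in DM *.
have [u0 u01 [_ uM]] := max_circle_attained (P \Po (k%:C *: 'X)).
have kC x : (P \Po (k%:C *: 'X)).[x] = P.[k%:C * x].
  by rewrite horner_comp hornerZ hornerX.
(* A point of the circle |z| = k where |P| is maximal. *)
set y := k%:C * u0.
have yk : normc y = k by rewrite normcM u01 mulr1 normc_real ?(ltW k0).
have PM x : normc x = k -> normc P.[x] <= normc P.[y].
  move=> xk; have := uM (k%:C^-1 * x); rewrite !kC mulVKf; last first.
    by apply/eqP => /(congr1 (@normc R)); rewrite normc_real ?normc0 ?(ltW k0)//; lra.
  by apply; rewrite normcM normcV xk normc_real ?(ltW k0)// mulVf// gt_eqF.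
have lower := gen_polar_circle_ge n_gt0 k0 PE' z_le gam_ge0 alpha_ge yk.
have upper : normc (gen_polar P z gam alpha).[y] <= k ^+ n.-1 * M1.
  by apply: max_modulus_growth => //; rewrite prednK// size_gen_polar.
have growth : 2 * k ^+ n * normc P.[v0] <= (1 + k ^+ n) * normc P.[y].
  have Ps : P = lead_coef P *: \prod_(w <- [seq z j | j <- enum 'I_n]) ('X - w%:P).
    by rewrite big_map big_enum.
  have sz : size [seq z j | j <- enum 'I_n] = n by rewrite size_map size_enum_ord.
  rewrite -{1 2}sz {1 2}Ps; apply: roots_in_disc_growth => //.
    by move=> w /mapP[j _ ->].
  by rewrite -Ps.
have H0 : 0 <= H.
  have [[m gm] _] := min_weightP n_gt0 gam.
  rewrite addr_ge0 ?sumr_ge0// gm mulr_ge0// divr_ge0//; last by lra.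
  rewrite subr_ge0 -[X in _ ^+ X](card_ord n) -prodr_const.
  by apply: ler_prod => j _; rewrite normc_ge0 z_le.
rewrite -/H in lower.
have a0 : 0 <= (normc alpha - k) * H by rewrite mulr_ge0// subr_ge0.
have := ler_wpM2l a0 growth.
have := ler_wpM2l (ltW k0) upper; rewrite mulrA -exprS prednK// => up.
move=> gr; rewrite -(ler_pM2r kn0).
have -> : (normc alpha - k) / (1 + k ^+ n) * H * normc P.[v0] * k ^+ n =
  ((normc alpha - k) * H) * (k ^+ n * normc P.[v0]) / (1 + k ^+ n).
  by field; rewrite gt_eqF//; lra.
rewrite ler_pdivrMr; last lra.
have : (normc alpha - k) * (H / 2) * normc P.[y] <= k ^+ n * M1.
  exact: le_trans lower up.
move=> low; have := ler_wpM2r (_ : 0 <= 1 + k ^+ n) low.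
have kn1 : 0 <= 1 + k ^+ n by lra.
move=> /(_ kn1); lra.
Qed.
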